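(* Let $I=(a,b)\subset\mathbb R$ be a bounded open interval, let $h:(\mathbb R\setminus\{0\})\times(\mathbb R\setminus\{0\})\to\mathbb R$ be symmetric and diagonal, and let $H$ be the functional defined on the space $PC(I)$ of piecewise constant functions on $I$ by $$H(u)=\sup_{(t,s)\in S(u)\times S(u)}h([u](t),[u](s)),\qquad u\in PC(I).$$ Then $H$ is lower semicontinuous on $PC(I)$ with respect to $L^1(I)$ convergence (that is, $H(u)\le\liminf_{n\to\infty}H(u_n)$ whenever $u_n,u\in PC(I)$ and $u_n\to u$ in $L^1(I)$) if and only if $h$ is lower semicontinuous on $(\mathbb R\setminus\{0\})\times(\mathbb R\setminus\{0\})$ and Cartesian submaximal.
   Context: **Piecewise constant functions.** A function $u:(a,b)\to\mathbb R$ is piecewise constant if there are points $a=t_0<t_1<\dots<t_N<t_{N+1}=b$ such that $u$ is a.e. constant on $(t_{i-1},t_i)$ for every $i=1,\dots,N+1$. $PC(I)\subset L^1(I)$ denotes the set of all such functions (identified when equal a.e.). $S(u)$ denotes the minimal set $\{t_1,\dots,t_N\}\subset(a,b)$ for which this holds (a finite, possibly empty, set), i.e. the jump set of $u$. For $t\in S(u)$, $[u](t):=u(t^+)-u(t^-)\neq 0$ is the difference of the right and left (approximate) limits of $u$ at $t$. **The functional.** The essential supremum in the definition of $H$ is taken with respect to the counting measure $\mathcal H^0$, so it is the supremum over the finite set $S(u)\times S(u)$; pairs with $t=s$ are included. The supremum over the empty set is $-\infty$, so $H$ takes values in the extended reals. **Symmetric.** $h$ is symmetric if $h(\xi,\eta)=h(\eta,\xi)$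 for all $\xi,\eta\in\mathbb R\setminus\{0\}$. **Diagonal.** For $c\in\mathbb R$ let $L_c(h)=\{(\xi,\eta): h(\xi,\eta)\le c\}$, and for a set $E$ of pairs let $\widehat E=\{(\xi,\eta)\in E:(\xi,\xi),(\eta,\eta),(\eta,\xi)\in E\}$. Put $\hat h(\xi,\eta)=\inf\{c\in\mathbb R:(\xi,\eta)\in\widehat{L_c(h)}\}$; equivalently $\hat h(\xi,\eta)=\max\{h(\xi,\xi),h(\eta,\eta),h(\eta,\xi),h(\xi,\eta)\}$. A symmetric $h$ is diagonal if $h=\hat h$ on $(\mathbb R\setminus\{0\})\times(\mathbb R\setminus\{0\})$. **Cartesian submaximal.** A symmetric and diagonal $h$ is Cartesian submaximal if $$h(w_1+w_2,y)\le\max\{h(w_1,y),h(w_2,y),h(w_1,w_2)\}\quad\text{for every }w_1,w_2,y\in\mathbb R,$$ where, for this condition, $h$ is extended to pairs having at least one zero entry by the value $\inf_{(\mathbb R\setminus\{0\})\times(\mathbb R\setminus\{0\})}h\in[-\infty,\infty)$. *)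

(* Defs.v *)
From HB Require Import structures.
From mathcomp Require Import all_boot all_order all_algebra.
From mathcomp Require Import all_classical all_reals all_analysis.

Set Implicit Arguments.
Unset Strict Implicit.
Unset Printing Implicit Defensive.

Import Order.TTheory GRing.Theory Num.Theory.
Import numFieldNormedType.Exports.

Local Open Scope classical_set_scope.
Local Open Scope ring_scope.

Section PiecewiseConstant.
Context {R : realType}.
Implicit Types (a b t l : R) (u v : R -> R) (ts : seq R).

Local Notation mu := (@lebesgue_measure R).

Definition ae_constant u s t :=
  exists c, {ae mu, forall x, x \in `]s, t[ -> u x = c}.

(* [ts] is t_1 < ... < t_N; the nodes are t_0 = a, ..., t_(N+1) = b. *)
Definition breakpoints a b u ts :=
  let nodes := a :: rcons ts b in
  sorted <%R nodes /\
  forall i, (i <= size ts)%N -> ae_constant u nodes`_i nodes`_i.+1.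

(* An element of PC(a, b) is given by a Borel representative R -> R; everything
   below depends only on its a.e. class on ]a, b[. *)
Definition PC a b u :=
  measurable_fun `]a, b[ u /\ exists ts, breakpoints a b u ts.

(* S(u): for u in PC(a, b), the least set of breakpoints under inclusion. *)
Definition jump_set a b u : set R :=
  smallest [set [set` ts] | ts in breakpoints a b u] set0.

(* One-sided approximate limits: for every e > 0, the set where |u - l| > e has
   one-sided density 0 at t. *)
Definition is_aplim_right u t l := forall e : R, 0 < e ->
  ((r^-1)%:E * mu (`]t, t + r[ `&` [set x | e < `|u x - l|])%R)%E @[r --> 0^'+]
    --> 0%E.

Definition is_aplim_left u t l := forall e : R, 0 < e ->
  ((r^-1)%:E * mu (`]t - r, t[ `&` [set x | e < `|u x - l|])%R)%E @[r --> 0^'+]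
    --> 0%E.

Definition aplim_right u t : R := xget 0 [set l | is_aplim_right u t l].
Definition aplim_left u t : R := xget 0 [set l | is_aplim_left u t l].

Definition jump u t : R := aplim_right u t - aplim_left u t.

Definition L1_cvg a b (un : (R -> R)^nat) u :=
  (\int[mu]_(x in `]a, b[) `|un n x - u x|%:E)%E @[n --> \oo] --> 0%E.

Definition PC_lsc a b (F : (R -> R) -> \bar R) :=
  forall (un : (R -> R)^nat) u,
    (forall n, PC a b (un n)) -> PC a b u -> L1_cvg a b un u ->
    (F u <= limn_einf (F \o un))%E.

End PiecewiseConstant.

(* A function h on (R \ {0}) x (R \ {0}) is given as a total h : R -> R -> R
   whose values at pairs with a zero entry are never used. *)
Section Supremands.
Context {R : realType}.
Implicit Type h : R -> R -> R.

Definition nonzero_pairs : set (R * R) := [set p | p.1 != 0 /\ p.2 != 0].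

Definition H_functional a b h (u : R -> R) : \bar R :=
  ereal_sup [set (h (jump u p.1) (jump u p.2))%:E
            | p in jump_set a b u `*` jump_set a b u].

Definition symmetric_density h :=
  forall x y : R, x != 0 -> y != 0 -> h x y = h y x.

Definition sublevel h (c : R) : set (R * R) :=
  [set p | nonzero_pairs p /\ h p.1 p.2 <= c].

Definition diag_set (E : set (R * R)) : set (R * R) :=
  [set p | E p /\ [/\ E (p.1, p.1), E (p.2, p.2) & E (p.2, p.1)]].

Definition diag_hull h (x y : R) : R :=
  inf [set c : R | diag_set (sublevel h c) (x, y)].

Definition diagonal_density h :=
  forall x y : R, x != 0 -> y != 0 -> h x y = diag_hull h x y.

Definition density_lsc h :=
  lower_semicontinuous
    ((fun p => (h p.1 p.2)%:E) : subspace nonzero_pairs -> \bar R).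

Definition ext0 h (x y : R) : \bar R :=
  if (x != 0) && (y != 0) then (h x y)%:E
  else ereal_inf [set (h p.1 p.2)%:E | p in nonzero_pairs].

Definition Cartesian_submaximal h := forall w1 w2 y : R,
  (ext0 h (w1 + w2) y
   <= maxe (maxe (ext0 h w1 y) (ext0 h w2 y)) (ext0 h w1 w2))%E.

End Supremands.

(* Main.v *)
(* Let v be the right-continuous representative of u in PC(a, b): for x <= y the
   increment v y - v x is a sum of jumps of u.

   Sufficiency. If H(u_n) <= c, the jumps of u_n are pairwise in {h <= c}, and
   Cartesian submaximality propagates this to arbitrary finite sums of jumps, hence
   to pairs of increments of u_n. If u_n -> u in L^1, two increments of u_n, taken
   across t and across s, approximate the jumps of u at t and s, so lower
   semicontinuity of h gives h([u](t), [u](s)) <= c.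

   Necessity. Test H on step functions with three jumps: perturbing the sizes of two
   jumps gives lower semicontinuity of h, and letting the jumps w1 and w2 merge into
   one jump w1 + w2 next to a jump y gives submaximality; by diagonality the value
   of H is controlled by the off-diagonal pairs. *)
Require Import Defs.
From mathcomp Require Import all_boot all_order all_algebra.
From mathcomp Require Import all_classical all_reals all_analysis.
From mathcomp Require Import measurable_realfun ring lra.

Set Implicit Arguments.
Unset Strict Implicit.
Unset Printing Implicit Defensive.

Import Order.TTheory GRing.Theory Num.Theory.
Import numFieldNormedType.Exports.
Local Open Scope classical_set_scope.
Local Open Scope ring_scope.

Section PiecewiseConstantFunctions.
Context {R : realType}.
Implicit Types (a b p q s t c e : R) (u v : R -> R) (ts : seq R).
Local Notation mu := (@lebesgue_measure R).

#[local] Instance ae_lebesgue_filter : Filter (nbhs (almost_everywhere mu)).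
Proof. exact: (ae_filter_ringOfSetsType mu). Qed.

(** * Almost everywhere constancy on intervals and lists of breakpoints *)

Definition const_on u p q c := {ae mu, forall x, x \in `]p, q[ -> u x = c}.

Definition avoids (T : set R) p q := forall t, T t -> t \notin `]p, q[.

Lemma const_onS {u p q c} p' q' :
  p <= p' -> q' <= q -> const_on u p q c -> const_on u p' q' c.
Proof.
move=> pp qq; apply: filterS => x /= uc; rewrite in_itv /= => /andP[px xq].
by apply: uc; rewrite in_itv /= (le_lt_trans pp px) (lt_le_trans xq qq).
Qed.

Lemma ae_constantS {u p q} p' q' :
  p <= p' -> q' <= q -> ae_constant u p q -> ae_constant u p' q'.
Proof. by move=> pp qq [c uc]; exists c; apply: const_onS uc. Qed.

Lemma breakpoints_nil a b u :
  breakpoints a b u [::] <-> a < b /\ ae_constant u a b.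
Proof.
rewrite /breakpoints /= andbT; split=> [[ab /(_ 0%N isT)]//|[ab uc]].
by split=> // -[|[]].
Qed.

Lemma breakpoints_cons a b u t ts :
  breakpoints a b u (t :: ts) <->
  [/\ a < t, ae_constant u a t & breakpoints t b u ts].
Proof.
rewrite /breakpoints /=; split=> [[/andP[at_ pth] H]|[at_ uat [pth H]]].
  split=> //; first exact: (H 0%N).
  by split=> // i ile; apply: (H i.+1).
split; first by rewrite at_.
by case=> [//|i] ile; apply: H.
Qed.

(** Trades the indexed nodes for a condition on arbitrary subintervals free of breakpoints. In this
    form a breakpoint can be deleted, or two lists merged, without any index bookkeeping. *)
Lemma breakpointsP a b u ts :
  breakpoints a b u ts <->
  [/\ a < b, sorted <%R ts, {in ts, forall t, t \in `]a, b[} &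
   forall p q, a <= p -> p < q -> q <= b -> avoids [set` ts] p q ->
     ae_constant u p q].
Proof.
elim: ts a => [|t ts IH] a.
  rewrite breakpoints_nil; split=> [[ab uc]|[ab _ _]].
    by split=> // p q ap _ qb _; exact: ae_constantS uc.
  by move=> uc; split=> //; exact: uc.
rewrite breakpoints_cons; split=> [[at_ uat /IH[tb sts tsab uc]]|].
  split.
  - exact: lt_trans tb.
  - rewrite /= path_sortedE; last exact: lt_trans.
    by rewrite sts andbT; apply/allP => x /tsab; rewrite in_itv /= => /andP[].
  - move=> x; rewrite inE => /orP[/eqP->|/tsab]; rewrite !in_itv /= ?at_ //.
    by move=> /andP[tx ->]; rewrite (lt_trans at_ tx).
  - move=> p q ap pq qb av.
    have := av t (mem_head _ _); rewrite in_itv /= negb_and -!leNgt.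
    case/orP => [tp|qt]; last exact: ae_constantS uat.
    by apply: uc => // x xts; apply: av; rewrite /= inE xts orbT.
move=> [ab /=]; rewrite path_sortedE; last exact: lt_trans.
move=> /andP[/allP tts sts] tsab uc.
have := tsab t (mem_head _ _); rewrite in_itv /= => /andP[at_ tb].
have tsab' : {in ts, forall x, x \in `]t, b[}.
  move=> x xts; rewrite in_itv /= tts //.
  by have := tsab x; rewrite inE xts orbT in_itv /= => /(_ isT)/andP[].
split=> //.
- apply: uc (ltW tb) _ => // x /=; rewrite inE in_itv /=
    => /orP[/eqP->|/tts tx].
    by rewrite ltxx andbF.
  by rewrite (lt_gtF tx) andbF.
- apply/IH; split=> // p q tp pq qb av; apply: uc => //.
    exact: le_trans (ltW at_) tp.
  move=> x /=; rewrite inE => /orP[/eqP->|]; last exact: av.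
  by rewrite in_itv /= ltNge tp.
Qed.

(** * One-sided approximate limits of functions that are constant on an interval *)

Lemma mu_inter_const_on u p q c (D : set R) (e l : R) :
  measurable_fun `]p, q[ u -> const_on u p q c ->
  measurable D -> D `<=` `]p, q[ ->
  mu (D `&` [set x | e < `|u x - l|]) = if e < `|c - l| then mu D else 0%E.
Proof.
move=> mfu uc mD Dpq.
pose S := D `&` [set x | e < `|u x - l|].
have mS : measurable S.
  have mf : measurable_fun D (fun x => `|u x - l|).
    apply: measurableT_comp => //; apply: measurable_funB => //.
    by apply: measurable_funS mfu.
  have := mf mD `]e, +oo[%classic (measurable_itv _).
  rewrite preimage_itvoy; congr measurable.
(* Up to this null set the intersection is all of [D] or empty, depending on whether [c] itself is
   farther than [e] from [l]. *)
have nD : mu.-negligible (D `&` [set x | u x <> c]).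
  apply: negligibleS uc => x /= [Dx ux] H; apply: ux; apply: H.
  exact: Dpq.
case: ifPn => ec; last first.
  apply: measure_negligible => //.
  apply: negligibleS nD => x [Dx ex]; split => //= ux.
  by move: ex; rewrite /= ux (negPf ec).
have mD' : measurable (D `\` S) by exact: measurableD.
have D0 : mu (D `\` S) = 0%E.
  apply: measure_negligible => //.
  apply: negligibleS nD => x [Dx ex]; split => //= ux.
  by apply: ex; split=> //=; rewrite ux.
by rewrite [RHS](measureDI mu mD mS) [X in (X + _)%E]D0 add0e setIA setIid.
Qed.

(** Common core of the left and right limits: [D r] will be the interval of length [r] on the chosen
    side of the point. For small [r] the density quotient is exactly 1 or 0, according to whether
    [e < |c - l|]. *)
Lemma densities_const_on u p q c l (D : R -> set R) :
  measurable_fun `]p, q[ u -> const_on u p q c ->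
  (\forall r \near 0^'+,
     [/\ measurable (D r), mu (D r) = r%:E & D r `<=` `]p, q[]) ->
  (forall e, 0 < e ->
    ((r^-1)%:E * mu (D r `&` [set x | e < `|u x - l|])%R)%E @[r --> 0^'+]
      --> 0%E) <-> l = c.
Proof.
move=> mfu uc nD; split=> [H|-> e e0]; last first.
  apply: cvg_near_cst; near=> r.
  have [mD _ Dpq] : [/\ measurable (D r), mu (D r) = r%:E & D r `<=` `]p, q[].
    by near: r.
  by rewrite (mu_inter_const_on _ _ mfu uc) // subrr normr0 (lt_gtF e0) mule0.
apply/eqP/negPn/negP => lc.
have cl0 : 0 < `|c - l| by rewrite normr_gt0 subr_eq0 eq_sym.
(* This threshold lies strictly below [|c - l|], so the quotient is eventually 1 and cannot tend to
   0. *)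
have e0 : 0 < `|c - l| / 2 by rewrite divr_gt0.
suff /cvg_unique-/(_ (@ereal_hausdorff _) _ (H _ e0))[] :
    ((r^-1)%:E * mu (D r `&` [set x | `|c - l| / 2 < `|u x - l|])%R)%E
      @[r --> 0^'+] --> 1%:E by move/eqP; rewrite oner_eq0.
apply: cvg_near_cst; near=> r.
have [mD muD Dpq] : [/\ measurable (D r), mu (D r) = r%:E & D r `<=` `]p, q[].
  by near: r.
rewrite (mu_inter_const_on _ _ mfu uc) // ltr_pdivrMr // ltr_pMr // ltr1n muD.
by rewrite -EFinM mulVf // gt_eqF.
Unshelve. all: by end_near. Qed.

Lemma aplim_right_const u p q c t : measurable_fun `]p, q[ u ->
  const_on u p q c -> p <= t -> t < q -> aplim_right u t = c.
Proof.
move=> mfu uc pt tq.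
have H l := @densities_const_on u p q c l (fun r => `]t, t + r[%classic)
  mfu uc.
have {}H l : is_aplim_right u t l <-> l = c.
  apply: H; near=> r; split=> //.
    rewrite lebesgue_measure_itv /= lte_fin ltrDl ifT //.
    by rewrite -EFinB addrAC subrr add0r.
  move=> x /=; rewrite !in_itv /= => /andP[tx xr]; rewrite (le_lt_trans pt tx).
  rewrite (lt_trans xr) // -ltrBrDl; near: r; apply: nbhs_right_lt.
  by rewrite subr_gt0.
by apply: xget_unique => [|y /H //]; apply/H.
Unshelve. all: by end_near. Qed.

Lemma aplim_left_const u p q c t : measurable_fun `]p, q[ u ->
  const_on u p q c -> p < t -> t <= q -> aplim_left u t = c.
Proof.
move=> mfu uc pt tq.
have H l := @densities_const_on u p q c l (fun r => `]t - r, t[%classic)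
  mfu uc.
have {}H l : is_aplim_left u t l <-> l = c.
  apply: H; near=> r; split=> //.
    rewrite lebesgue_measure_itv /= lte_fin gtrBl ifT //.
    by rewrite -EFinB opprB addrC subrK.
  move=> x /=; rewrite !in_itv /= => /andP[rx xt]; rewrite (lt_le_trans xt tq).
  rewrite (lt_trans _ rx) // ltrBrDr -ltrBrDl; near: r; apply: nbhs_right_lt.
  by rewrite subr_gt0.
by apply: xget_unique => [|y /H //]; apply/H.
Unshelve. all: by end_near. Qed.

(** * Gluing across a point, and the jump set as the set of points with nonzero jump *)

Lemma ae_neq t : {ae mu, forall x, x != t}.
Proof.
exists [set t]; split => //; first exact: lebesgue_measure_set1.
by move=> x /= /negP; rewrite negbK => /eqP.
Qed.

Lemma const_on_cat u p t q c :
  const_on u p t c -> const_on u t q c -> const_on u p q c.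
Proof.
move=> pt tq; have xt := ae_neq t.
apply: filterS3 pt tq xt => x pt tq xt; rewrite in_itv /= => /andP[px xq].
by case: (ltgtP x t) xt => // [xt|tx] _; [apply: pt|apply: tq];
  rewrite in_itv /= ?px ?xt ?tx ?xq.
Qed.

Lemma avoids_right ts t b : t < b ->
  exists q, [/\ t < q, q <= b & avoids [set` ts] t q].
Proof.
move=> tb; elim: ts => [|s ts [q [tq qb av]]]; first by exists b.
have [ts_|st] := ltP t s; last first.
  exists q; split=> // x /=; rewrite inE => /orP[/eqP->|]; last exact: av.
  by rewrite in_itv /= ltNge st.
exists (Num.min q s); split; rewrite ?lt_min ?ge_min ?tq ?qb //.
move=> x /=; rewrite inE in_itv /= lt_min => /orP[/eqP->|/av].
  by rewrite ltxx !andbF.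
by rewrite in_itv /= negb_and => /orP[/negPf->//|/negPf->]; rewrite andbF.
Qed.

Lemma avoids_left ts t a : a < t ->
  exists p, [/\ a <= p, p < t & avoids [set` ts] p t].
Proof.
move=> at_; elim: ts => [|s ts [p [ap pt av]]]; first by exists a.
have [st|ts_] := ltP s t; last first.
  exists p; split=> // x /=; rewrite inE => /orP[/eqP->|]; last exact: av.
  by rewrite in_itv /= (ltNge s) ts_ andbF.
exists (Num.max p s); split; rewrite ?gt_max ?le_max ?pt ?ap //.
move=> x /=; rewrite inE in_itv /= gt_max => /orP[/eqP->|/av].
  by rewrite ltxx !andbF.
by rewrite in_itv /= negb_and => /orP[/negPf->//|/negPf->]; rewrite andbF.
Qed.

Lemma measurable_itvS u a b p q : a <= p -> q <= b ->
  measurable_fun `]a, b[ u -> measurable_fun `]p, q[ u.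
Proof.
move=> ap qb; apply: measurable_funS => // x /=; rewrite !in_itv /=.
by move=> /andP[px xq]; rewrite (le_lt_trans ap px) (lt_le_trans xq qb).
Qed.

Lemma PC_right a b u t : PC a b u -> a <= t -> t < b ->
  exists q, [/\ t < q, q <= b & const_on u t q (aplim_right u t)].
Proof.
move=> [mfu [ts /breakpointsP[_ _ _ uc]]] at_ tb.
have [q [tq qb /(uc _ _ at_ tq qb)[c utq]]] := avoids_right ts tb.
exists q; split=> //; rewrite (aplim_right_const _ utq) //.
exact: measurable_itvS mfu.
Qed.

Lemma PC_left a b u t : PC a b u -> a < t -> t <= b ->
  exists p, [/\ a <= p, p < t & const_on u p t (aplim_left u t)].
Proof.
move=> [mfu [ts /breakpointsP[_ _ _ uc]]] at_ tb.
have [p [ap pt /(uc _ _ ap pt tb)[c upt]]] := avoids_left ts at_.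
exists p; split=> //; rewrite (aplim_left_const _ upt) //.
exact: measurable_itvS mfu.
Qed.

Lemma jump_setE a b u : PC a b u ->
  jump_set a b u = [set t | (t \in `]a, b[) /\ (jump u t != 0)].
Proof.
move=> PCu; have [mfu [ts bts]] := PCu.
have /breakpointsP[ab sts tsab uc] := bts.
apply/seteqP; split=> t.
  move=> ttss.
  have /= tts := ttss [set` ts]
    (conj (ex_intro2 _ _ ts bts erefl) (@sub0set _ _)).
  have tab := tsab _ tts; split=> //; apply/negP => /eqP/subr0_eq jt.
  (* Deleting [t] still leaves a list of breakpoints: an interval containing [t] is cut at [t] into
     two pieces, whose constants are the one-sided limits at [t] and hence agree. *)
  pose ts' := [seq x <- ts | x != t].
  have bts' : breakpoints a b u ts'.
    apply/breakpointsP; split=> //.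
    - by apply: sorted_filter => //; exact: lt_trans.
    - by move=> x; rewrite mem_filter => /andP[_ /tsab].
    move=> p q ap pq qb av; have [tpq|tpq] := boolP (t \in `]p, q[); last first.
      apply: uc => // x xts; have [->//|xt] := eqVneq x t.
      by apply: av; rewrite /= mem_filter xt.
    move: (tpq); rewrite in_itv /= => /andP[pt tq].
    have avp : avoids [set` ts] p t.
      move=> x xts; have [->|xt] := eqVneq x t.
        by rewrite in_itv /= ltxx andbF.
      have := av x; rewrite /= mem_filter xt => /(_ xts).
      by apply: contra; rewrite !in_itv /= => /andP[-> /lt_trans]; apply.
    have avq : avoids [set` ts] t q.
      move=> x xts; have [->|xt] := eqVneq x t.
        by rewrite in_itv /= ltxx.
      have := av x; rewrite /= mem_filter xt => /(_ xts).
      by apply: contra; rewrite !in_itv /= => /andP[/(lt_trans pt)->].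
    have [c1 u1] := uc _ _ ap pt (le_trans (ltW tq) qb) avp.
    have [c2 u2] := uc _ _ (le_trans ap (ltW pt)) tq qb avq.
    exists c1; apply: const_on_cat (u1) _.
    have m1 : measurable_fun `]p, t[ u.
      by apply: measurable_itvS mfu => //; exact: le_trans (ltW tq) qb.
    have m2 : measurable_fun `]t, q[ u.
      by apply: measurable_itvS mfu => //; exact: le_trans ap (ltW pt).
    by rewrite -(aplim_left_const m1 u1 pt (lexx t)) -jt
      (aplim_right_const m2 u2).
  have := ttss [set` ts']
    (conj (ex_intro2 _ _ ts' bts' erefl) (@sub0set _ _)).
  by rewrite /= mem_filter eqxx.
move=> [tab jt] _ [[ts' bts' <-] _] /=; apply: contraNT jt => tts'.
have /breakpointsP[_ _ _ uc'] := bts'.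
move: tab; rewrite in_itv /= => /andP[at_ tb].
have [p [ap pt avl]] := avoids_left ts' at_.
have [q [tq qb avr]] := avoids_right ts' tb.
have [|c uc''] := uc' p q ap (lt_trans pt tq) qb.
  move=> x xts'; have := avl _ xts'; have := avr _ xts'; rewrite !in_itv /=.
  have : x != t by apply: contraNneq tts' => <-.
  by case: (ltgtP x t) => // [xt|tx] _; rewrite !(andbT, andTb);
    [move=> _ /negPf->|move=> /negPf->; rewrite andbF].
have mpq : measurable_fun `]p, q[ u by exact: measurable_itvS mfu.
by rewrite /jump (aplim_right_const mpq uc'') ?(aplim_left_const mpq uc'') ?subrr
  ?ltW.
Qed.

(** * The right-continuous representative and its increments *)

Lemma ae_eq_aplim_right a b u :
  PC a b u -> {ae mu, forall x, x \in `]a, b[ -> u x = aplim_right u x}.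
Proof.
have const p q c : measurable_fun `]p, q[ u -> const_on u p q c ->
    {ae mu, forall x, x \in `]p, q[ -> u x = aplim_right u x}.
  move=> mpq uc; apply: filterS (uc) => x ux xpq; rewrite ux //.
  move: xpq; rewrite in_itv /= => /andP[px xq].
  by rewrite (aplim_right_const mpq uc) // ltW.
case=> + [ts]; elim: ts a => [|t ts IH] a mfu.
  by move=> /breakpoints_nil[_ [c]]; apply: const.
move=> /breakpoints_cons[at_ [c uc] bts].
have [tb _ _ _] := (breakpointsP t b u ts).1 bts.
have {}uc : {ae mu, forall x, x \in `]a, t[ -> u x = aplim_right u x}.
  by apply: const uc; apply: measurable_itvS mfu => //; exact: ltW.
have ut := IH t (measurable_itvS (ltW at_) (lexx b) mfu) bts.
have xt := ae_neq t; apply: filterS3 uc ut xt => x u1 u2.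
rewrite in_itv /= => + /andP[ax xb].
by case: (ltgtP x t) => // [xt|tx] _; [apply: u1|apply: u2];
  rewrite in_itv /= ?ax ?xt ?tx ?xb.
Qed.

(** An induction principle expressing that an increment of the right-continuous representative is a
    finite sum of jumps: any [M] containing 0 and stable under adding a jump contains every
    increment. The induction peels off the leftmost breakpoint. *)
Lemma aplim_right_increment a b u (M : set R) x y :
  PC a b u -> M 0 ->
  (forall t w, t \in `]a, b[ -> M w -> M (jump u t + w)) ->
  a <= x -> x <= y -> y < b -> M (aplim_right u y - aplim_right u x).
Proof.
case=> + [ts] + M0; elim: ts a x => [|t ts IH] a x mfu.
  move=> /breakpoints_nil[_ [c uc]] _ ax xy yb.
  rewrite (aplim_right_const mfu uc) // ?(aplim_right_const mfu uc) ?subrr //.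
    exact: le_lt_trans xy yb.
  exact: le_trans ax xy.
move=> /breakpoints_cons[at_ [c uc] bts] MD ax xy yb.
have [tb _ _ _] := (breakpointsP t b u ts).1 bts.
have m1 : measurable_fun `]a, t[ u.
  by apply: measurable_itvS mfu => //; exact: ltW.
have m2 : measurable_fun `]t, b[ u.
  by apply: measurable_itvS mfu => //; exact: ltW.
have MD' s w : s \in `]t, b[ -> M w -> M (jump u s + w).
  move=> stb; apply: MD; move: stb; rewrite !in_itv /= => /andP[ts_ ->].
  by rewrite (lt_trans at_).
have [tx|xt] := leP t x; first exact: (IH t).
rewrite (aplim_right_const m1 uc ax xt).
have [ty|yt] := leP t y; last first.
  by rewrite (aplim_right_const m1 uc) ?subrr // (le_trans ax xy).
(* Here [x < t <= y], and the value at [x] is the left limit at the first breakpoint [t]; the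
   increment therefore splits into the jump at [t] and the increment from [t] to [y]. *)
rewrite -(aplim_left_const m1 uc at_ (lexx t)).
have -> : aplim_right u y - aplim_left u t =
    jump u t + (aplim_right u y - aplim_right u t).
  by rewrite /jump [RHS]addrC addrA subrK.
by apply: MD; [rewrite in_itv /= at_|apply: (IH t)].
Qed.

(** A Chebyshev argument: if [|u - v|] were at least [e] wherever [P] holds, hence a.e. on []p, q[],
    its integral would be at least [e * (q - p)]. *)
Lemma exists_close_point a b u v p q e (P : set R) :
  measurable_fun `]a, b[ u -> measurable_fun `]a, b[ v ->
  a <= p -> p < q -> q <= b -> 0 < e -> {ae mu, forall x, P x} ->
  (\int[mu]_(x in `]a, b[) `|u x - v x|%:E < (e * (q - p))%:E)%E ->
  exists x, [/\ x \in `]p, q[, P x & `|u x - v x| < e].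
Proof.
move=> mfu mfv ap pq qb e0 aeP; rewrite ltNge => /negP I.
apply/not_existsP => H; apply: I.
have mab : measurable_fun `]a, b[ (@EFin R \o (fun x => `|u x - v x|)).
  apply/measurable_EFinP; apply: measurableT_comp => //.
  exact: measurable_funB.
have pqab : `]p, q[ `<=` `]a, b[.
  move=> x /=; rewrite !in_itv /= => /andP[px xq].
  by rewrite (le_lt_trans ap px) (lt_le_trans xq qb).
apply: (@le_trans _ _ (\int[mu]_(x in `]p, q[) `|u x - v x|%:E)%E); last first.
  by apply: ge0_subset_integral => // x _; rewrite lee_fin.
have <- : (\int[mu]_(x in `]p, q[) e%:E = (e * (q - p))%:E)%E.
  by rewrite integral_cst //= lebesgue_measure_itv /= lte_fin pq EFinM EFinB.
apply: ae_ge0_le_integral => //.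
- by move=> *; rewrite lee_fin ltW.
- exact: measurable_funS mab.
apply: filterS aeP => x Px xpq; rewrite lee_fin leNgt; apply/negP => xe.
by apply: (H x).
Qed.

(** * Propagation of a bound on [h] from jumps to sums of jumps *)

Section Suprema.
Variables (h : R -> R -> R) (c : R).
Hypotheses (hsym : symmetric_density h) (hsub : Cartesian_submaximal h).

(* With [h] extended to zero entries by its infimum, this is [h x y <= c] as soon
   as the sublevel set is nonempty. *)
Definition compatible x y := x = 0 \/ y = 0 \/ h x y <= c.

Lemma compatibleC x y : compatible x y -> compatible y x.
Proof.
case=> [->|[->|hxy]]; [by right; left|by left|].
have [->|x0] := eqVneq x 0; first by right; left.
have [->|y0] := eqVneq y 0; first by left.
by right; right; rewrite hsym.
Qed.

(** Submaximality read on a sublevel set: the three hypotheses bound the three terms of the maximum,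
    and every case with a zero entry is immediate. *)
Lemma compatibleD x1 x2 y : compatible x1 x2 ->
  compatible x1 y -> compatible x2 y -> compatible (x1 + x2) y.
Proof.
have [->|n1] := eqVneq x1 0; first by rewrite add0r.
have [->|n2] := eqVneq x2 0; first by rewrite addr0.
have [->|ny] := eqVneq y 0; first by right; left.
have [->|n12] := eqVneq (x1 + x2) 0; first by left.
case=> [/eqP|[/eqP|h12]]; rewrite ?(negPf n1) ?(negPf n2) //.
case=> [/eqP|[/eqP|h1]]; rewrite ?(negPf n1) ?(negPf ny) //.
case=> [/eqP|[/eqP|h2]]; rewrite ?(negPf n2) ?(negPf ny) //.
right; right; rewrite -lee_fin; have := hsub x1 x2 y.
rewrite /ext0 n1 n2 ny n12 /= => /le_trans; apply.
by rewrite !ge_max !lee_fin h1 h2.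
Qed.

(** Two inductions: first a sum against a single element, then a sum against a sum. Adding [x] to a
    partial sum requires [x] to be compatible with that partial sum, which is why the first
    induction keeps [y] general. *)
Lemma compatible_sums (A : set R) (l1 l2 : seq R) :
  (forall x y, A x -> A y -> compatible x y) ->
  {in l1, forall x, A x} -> {in l2, forall x, A x} ->
  compatible (\sum_(x <- l1) x) (\sum_(x <- l2) x).
Proof.
move=> cA.
have tailA (x : R) l : {in x :: l, forall z, A z} -> {in l, forall z, A z}.
  by move=> Al z zl; apply: Al; rewrite inE zl orbT.
have cs y (l : seq R) : A y -> {in l, forall x, A x} ->
    compatible (\sum_(x <- l) x) y.
  elim: l y => [|x l IH] y Ay Al; first by rewrite big_nil; left.
  have Ax := Al x (mem_head _ _); have {}Al := tailA _ _ Al.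
  rewrite big_cons; apply: compatibleD; [|exact: cA|exact: IH].
  exact/compatibleC/IH.
move=> + Al2; elim: l1 => [|x l IH] Al; first by rewrite big_nil; left.
have Ax := Al x (mem_head _ _); have {}Al := tailA _ _ Al.
rewrite big_cons; apply: compatibleD; last exact: IH.
all: exact/compatibleC/cs.
Qed.

End Suprema.

(** * Lower limits in the extended reals and lower semicontinuity of [h] on balls *)

Lemma limn_einf_lt (f : (\bar R)^nat) (l : \bar R) (P : set nat) :
  (limn_einf f < l)%E -> (\forall n \near \oo, P n) ->
  exists2 n, P n & (f n < l)%E.
Proof.
rewrite /limn_einf lteNl => fl nP.
have /ereal_sup_gt[_ [n Pn <-]] : (- l < ereal_sup ((\- f)%E @` P))%E.
  by apply: lt_le_trans fl _; apply: ereal_inf_lbound; exists P.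
by rewrite lteN2 => nl; exists n.
Qed.

Lemma limn_einf_le (f : (\bar R)^nat) (l : \bar R) :
  (forall n, f n <= l)%E -> (limn_einf f <= l)%E.
Proof.
move=> fl; rewrite leNgt; apply/negP.
rewrite /limn_einf lteNr => /ereal_inf_lt[_ [P nP <-]].
have [n Pn] := @filter_ex _ _ _ _ nP.
rewrite ltNge => /negP; apply; apply: (@le_trans _ _ (- f n)%E).
  by rewrite leeN2.
by apply: ereal_sup_ubound; exists n.
Qed.

(** The left bound will be a lower limit of values of [H_functional], which may be [-oo] since the
    functional is [-oo] at functions without jumps. *)
Lemma ereal_lt_between (x : \bar R) (r : R) :
  (x < r%:E)%E -> exists2 c : R, (x < c%:E)%E & c < r.
Proof.
case: x => [x||] //; first by rewrite lte_fin => xr; exists ((x + r) / 2);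
  rewrite ?lte_fin midf_lt.
by move=> _; exists (r - 1); rewrite ?ltNyr // gtrBl.
Qed.

Lemma density_lsc_ball (h : R -> R -> R) x y c :
  density_lsc h -> x != 0 -> y != 0 -> c < h x y ->
  exists2 e : R, 0 < e & forall x' y', `|x' - x| < e -> `|y' - y| < e ->
    [/\ x' != 0, y' != 0 & c < h x' y'].
Proof.
move=> hlsc x0 y0 cxy.
have Axy : (@nonzero_pairs R) (x, y) by [].
have [|V + VP] := hlsc (x, y) c; first by rewrite lte_fin.
rewrite /nbhs /= -(nbhs_subspace_in Axy) => /nbhs_ballP[e /= e0 eV].
(* Keeping the radius at most [|x|] and [|y|] forces the perturbed entries to be nonzero, so the
   perturbed pair stays in the subspace. *)
exists (Num.min e (Num.min `|x| `|y|)).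
  by rewrite !lt_min e0 !normr_gt0 x0.
move=> x' y'; rewrite !lt_min => /and3P[xe xx _] /and3P[ye _ yy].
have neq0 (z z' : R) : `|z' - z| < `|z| -> z' != 0.
  by apply: contraTneq => ->; rewrite sub0r normrN ltxx.
have x'0 := neq0 _ _ xx; have y'0 := neq0 _ _ yy.
split=> //; rewrite -lte_fin; apply: (VP (x', y')); apply: eV => //.
by split; rewrite /ball /= distrC.
Qed.

(** * Sufficiency: lower semicontinuity of the functional *)

Lemma lsc_of_submaximal a b (h : R -> R -> R) :
  symmetric_density h -> density_lsc h -> Cartesian_submaximal h ->
  PC_lsc a b (H_functional a b h).
Proof.
move=> hsym hlsc hsub un u PCn PCu unu; rewrite leNgt; apply/negP.
move=> /ereal_sup_gt[_ [[t s] [/= tS sS] <-]] /ereal_lt_between[c cinf ch].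
move: tS sS; rewrite (jump_setE PCu) => -[tab jt] [sab js].
have [e e0 He] := density_lsc_ball hlsc jt js ch.
move: tab sab; rewrite !in_itv /= => /andP[at_ tb] /andP[as_ sb].
(* On each side of [t] and of [s], [u] is a.e. equal to its one-sided limit on some interval; [un n]
   is sampled at one point of each of these four intervals. *)
have [p1 [ap1 p1t u1]] := PC_left PCu at_ (ltW tb).
have [q1 [tq1 q1b u2]] := PC_right PCu (ltW at_) tb.
have [p2 [ap2 p2s u3]] := PC_left PCu as_ (ltW sb).
have [q2 [sq2 q2b u4]] := PC_right PCu (ltW as_) sb.
have e20 : 0 < e / 2 by rewrite divr_gt0.
have close p q l : a <= p -> p < q -> q <= b -> const_on u p q l ->
    \forall n \near \oo, exists2 x,
      x \in `]p, q[ & `|aplim_right (un n) x - l| < e / 2.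
  move=> ap pq qb upq.
  have K0 : (0 < (e / 2 * (q - p))%:E)%E.
    by rewrite lte_fin mulr_gt0 // subr_gt0.
  have : \forall n \near \oo,
      (\int[mu]_(x in `]a, b[) `|un n x - u x|%:E < (e / 2 * (q - p))%:E)%E.
    apply: (unu [set y | (y < (e / 2 * (q - p))%:E)%E]).
    by apply: open_nbhs_nbhs; split=> //; exact: open_ereal_lt_ereal.
  apply: filterS => n In.
  have aeP := @filterI _ _ ae_lebesgue_filter _ _
    (ae_eq_aplim_right (PCn n)) upq.
  have [x [xpq [ux vx] xe]] :=
    exists_close_point (PCn n).1 PCu.1 ap pq qb e20 aeP In.
  exists x => //; rewrite -ux -?(vx xpq) //.
  by move: xpq; rewrite !in_itv /= => /andP[px xq];
    rewrite (le_lt_trans ap px) (lt_le_trans xq qb).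
(* A single index for which all four samples are close and the functional is below [c]. *)
have [n [[[x1 x1i x1e] [x2 x2i x2e]] [[x3 x3i x3e] [x4 x4i x4e]]] Hn] :=
  limn_einf_lt cinf (filterI
    (filterI (close _ _ _ ap1 p1t (ltW tb) u1)
             (close _ _ _ (ltW at_) tq1 q1b u2))
    (filterI (close _ _ _ ap2 p2s (ltW sb) u3)
             (close _ _ _ (ltW as_) sq2 q2b u4))).
(* Zero jumps are kept in [A], since [compatible] accepts them; nonzero ones belong to the jump set,
   where the bound on the functional applies. *)
pose A := [set jump (un n) r | r in `]a, b[%classic].
have cA x y : A x -> A y -> compatible h c x y.
  move=> [r rab <-] [r' r'ab <-].
  have [->|j1] := eqVneq (jump (un n) r) 0; first by left.
  have [->|j2] := eqVneq (jump (un n) r') 0; first by right; left.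
  right; right; rewrite -lee_fin; apply: le_trans (ltW Hn).
  apply: ereal_sup_ubound; exists (r, r') => //=.
  by rewrite (jump_setE (PCn n)).
pose M :=
  [set w | exists2 l : seq R, {in l, forall x, A x} & w = \sum_(x <- l) x].
have MA x y : a <= x -> x <= y -> y < b ->
    M (aplim_right (un n) y - aplim_right (un n) x).
  apply: aplim_right_increment (PCn n) _ _.
    by exists [::]; rewrite ?big_nil.
  move=> r w rab [l lA ->]; exists (jump (un n) r :: l); rewrite ?big_cons //.
  by move=> z; rewrite inE => /orP[/eqP->|/lA//]; exists r.
(* Samples left and right of [m], each within [e / 2] of its limit, give an increment, and so a sum
   of jumps, within [e] of [l' - l]. *)
have incr p q x y m l l' : a <= p -> q <= b -> x \in `]p, m[ -> y \in `]m, q[ ->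
    `|aplim_right (un n) x - l| < e / 2 ->
    `|aplim_right (un n) y - l'| < e / 2 ->
    exists2 w, M w & `|w - (l' - l)| < e.
  rewrite !in_itv /= => ap qb /andP[px xm] /andP[my yq] xe ye.
  exists (aplim_right (un n) y - aplim_right (un n) x).
    apply: MA; first exact: ltW (le_lt_trans ap px).
      exact: ltW (lt_trans xm my).
    exact: lt_le_trans yq qb.
  have -> : aplim_right (un n) y - aplim_right (un n) x - (l' - l) =
    (aplim_right (un n) y - l') - (aplim_right (un n) x - l) by ring.
  by rewrite (le_lt_trans (ler_normB _ _)) // (splitr e) ltrD.
have [w1 [l1 l1A ->] w1e] := incr _ _ _ _ _ _ _ ap1 q1b x1i x2i x1e x2e.
have [w2 [l2 l2A ->] w2e] := incr _ _ _ _ _ _ _ ap2 q2b x3i x4i x3e x4e.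
(* Near the jumps of [u] at [t] and [s] the density exceeds [c], whereas the two sums of jumps are
   compatible and both nonzero: a contradiction. *)
have [w10 w20] := He _ _ w1e w2e; rewrite ltNge => /negP; apply.
case: (compatible_sums hsym hsub cA l1A l2A) => [/eqP|[/eqP|//]].
  by rewrite (negPf w10).
by rewrite (negPf w20).
Qed.

Definition step p (w x : R) : R := if p <= x then w else 0.

Lemma measurable_step (D : set R) p w :
  measurable D -> measurable_fun D (step p w).
Proof.
move=> mD; apply: measurable_funS (@measurableT _ _) (@subsetT _ _) _.
rewrite /step; apply: measurable_fun_ifT => //; exact: measurable_fun_ler.
Qed.

Lemma const_on_step p w s t : p \notin `]s, t[ ->
  const_on (step p w) s t (if p <= s then w else 0).
Proof.
move=> pst; apply: aeW => x; rewrite in_itv /= => /andP[sx xt].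
rewrite /step; case: (leP p s) => [ps|sp].
  by rewrite (le_trans ps) // ltW.
rewrite ifF //; apply: contraNF pst => px; rewrite in_itv /= sp.
exact: le_lt_trans px xt.
Qed.

Lemma PC_step a b p w : p \in `]a, b[ -> PC a b (step p w).
Proof.
rewrite in_itv /= => /andP[ap pb]; split; first exact: measurable_step.
exists [:: p]; apply/breakpoints_cons; split => //.
  by eexists; apply: const_on_step; rewrite in_itv /= ltxx andbF.
apply/breakpoints_nil; split=> //.
by eexists; apply: const_on_step; rewrite in_itv /= ltxx.
Qed.

Lemma jump_step p w t : jump (step p w) t = if t == p then w else 0.
Proof.
have right q : t < q -> p \notin `]t, q[ ->
    aplim_right (step p w) t = if p <= t then w else 0.
  move=> tq pq; apply: (aplim_right_const _ (const_on_step w pq)) => //.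
  exact: measurable_step.
have left q : q < t -> p \notin `]q, t[ ->
    aplim_left (step p w) t = if p <= q then w else 0.
  move=> tq pq; apply: (aplim_left_const _ (const_on_step w pq)) => //.
  exact: measurable_step.
rewrite /jump; case: (ltgtP t p) => [tp|pt|tp].
- rewrite (right p) ?in_itv /= ?ltxx ?andbF // (left (t - 1)) ?gtrBl ?in_itv /=.
  + rewrite (lt_geF tp) ifF ?subrr //.
    by rewrite leNgt (lt_trans _ tp) // gtrBl.
  + by [].
  + by rewrite (ltNge p) (ltW tp) andbF.
- rewrite (right (t + 1)) ?ltrDl ?in_itv //= ?(lt_gtF pt) // (ltW pt).
  by rewrite (left p) ?in_itv /= ?ltxx // lexx subrr.
- rewrite tp in right left *.
  rewrite (right (p + 1)) ?ltrDl ?in_itv //= ?ltxx // lexx.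
  by rewrite (left (p - 1)) ?gtrBl ?in_itv /= ?ltxx ?andbF // leNgt
    gtrBl ltr01 subr0.
Qed.

Lemma const_onD u v s t c d :
  const_on u s t c -> const_on v s t d -> const_on (u \+ v) s t (c + d).
Proof.
move=> uc vd; apply: filterS2 uc vd => x uc vd xst.
by rewrite /= uc ?vd.
Qed.

Lemma PC_add a b u v : PC a b u -> PC a b v -> PC a b (u \+ v).
Proof.
move=> [mfu [us /breakpointsP[ab _ usab uc]]].
move=> [mfv [vs /breakpointsP[_ _ vsab vc]]].
split; first exact: measurable_funD.
(* Duplicates are removed because breakpoints must be strictly increasing. *)
exists (sort <=%R (undup (us ++ vs))); apply/breakpointsP; split=> //.
- by rewrite sort_lt_sorted undup_uniq.
- by move=> x; rewrite mem_sort mem_undup mem_cat => /orP[/usab|/vsab].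
- move=> p q ap pq qb av.
  have [|c u_c] := uc p q ap pq qb.
    by move=> x xus; apply: av; rewrite /= mem_sort mem_undup mem_cat xus.
  have [|d v_d] := vc p q ap pq qb.
    by move=> x xus; apply: av; rewrite /= mem_sort mem_undup mem_cat xus orbT.
  by exists (c + d); exact: const_onD.
Qed.

Lemma jump_add a b u v t : PC a b u -> PC a b v -> t \in `]a, b[ ->
  jump (u \+ v) t = jump u t + jump v t.
Proof.
move=> PCu PCv; rewrite in_itv /= => /andP[at_ tb].
have [muv _] := PC_add PCu PCv.
have [q1 [tq1 q1b u1]] := PC_right PCu (ltW at_) tb.
have [q2 [tq2 q2b v2]] := PC_right PCv (ltW at_) tb.
have [p1 [ap1 p1t u3]] := PC_left PCu at_ (ltW tb).
have [p2 [ap2 p2t v4]] := PC_left PCv at_ (ltW tb).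
pose q := Num.min q1 q2; pose p := Num.max p1 p2.
have tq : t < q by rewrite lt_min tq1.
have pt : p < t by rewrite gt_max p1t.
have qb : q <= b by rewrite ge_min q1b.
have ap : a <= p by rewrite le_max ap1.
have cr : const_on (u \+ v) t q (aplim_right u t + aplim_right v t).
  apply: const_onD; [apply: const_onS u1 => //|apply: const_onS v2 => //];
  by rewrite ge_min lexx ?orbT.
have cl : const_on (u \+ v) p t (aplim_left u t + aplim_left v t).
  apply: const_onD; [apply: const_onS u3 => //|apply: const_onS v4 => //];
  by rewrite le_max lexx ?orbT.
have mr : measurable_fun `]t, q[ (u \+ v) := measurable_itvS (ltW at_) qb muv.
have ml : measurable_fun `]p, t[ (u \+ v) := measurable_itvS ap (ltW tb) muv.
by rewrite /jump (aplim_right_const mr cr) // (aplim_left_const ml cl) //; ring.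
Qed.

Lemma H_functional_ge a b (h : R -> R -> R) u t s :
  PC a b u -> t \in `]a, b[ -> s \in `]a, b[ ->
  jump u t != 0 -> jump u s != 0 ->
  ((h (jump u t) (jump u s))%:E <= H_functional a b h u)%E.
Proof.
move=> PCu tab sab jt js; apply: ereal_sup_ubound; exists (t, s) => //=.
by rewrite (jump_setE PCu).
Qed.

Lemma diagonal_le (h : R -> R -> R) x y : diagonal_density h ->
  x != 0 -> y != 0 -> [/\ h x x <= h x y, h y y <= h x y & h y x <= h x y].
Proof.
move=> hdiag x0 y0; rewrite (hdiag x y) //.
(* A real [inf] is informative only on a nonempty set; the maximum of the four values is an
   admissible [c]. *)
have ne : [set c : R | diag_set (sublevel h c) (x, y)] !=set0.
  exists (Num.max (Num.max (h x x) (h y y)) (Num.max (h x y) (h y x))).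
  by rewrite /diag_set /sublevel /nonzero_pairs /= !le_max !lexx !orbT.
by split; apply: lb_le_inf => // c [_ [[_ ?] [_ ?] [_ ?]]].
Qed.

(** One family serves both tests: with [w2 = 0] it has the two jumps to be perturbed, and letting
    [q] tend to [p] merges [w1] and [w2]. *)
Definition step3 p q s (w1 w2 y : R) : R -> R :=
  step p w1 \+ (step q w2 \+ step s y).

Section Step3.
Variables (a b p q s : R).
Hypotheses (ap : a < p) (pq : p < q) (qs : q < s) (sb : s < b).
Variables (h : R -> R -> R) (w1 w2 y : R).

Let pab : p \in `]a, b[.
Proof. by rewrite in_itv /= ap (lt_trans pq) // (lt_trans qs). Qed.
Let qab : q \in `]a, b[.
Proof. by rewrite in_itv /= (lt_trans ap pq) (lt_trans qs). Qed.
Let sab : s \in `]a, b[.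
Proof. by rewrite in_itv /= sb andbT (lt_trans ap) // (lt_trans pq). Qed.

Lemma PC_step3 : PC a b (step3 p q s w1 w2 y).
Proof. by do ![apply: PC_add]; apply: PC_step. Qed.

Lemma jump_step3 t : t \in `]a, b[ -> jump (step3 p q s w1 w2 y) t =
  (if t == p then w1 else 0) +
  ((if t == q then w2 else 0) + (if t == s then y else 0)).
Proof.
move=> tab; have Ps := PC_step y sab; have Pq := PC_step w2 qab.
rewrite (jump_add (PC_step w1 pab) (PC_add Pq Ps) tab) (jump_add Pq Ps tab).
by rewrite !jump_step.
Qed.

Lemma H_step3_ge : w1 != 0 -> y != 0 ->
  ((h w1 y)%:E <= H_functional a b h (step3 p q s w1 w2 y))%E.
Proof.
move=> w10 y0.
have jp : jump (step3 p q s w1 w2 y) p = w1.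
  by rewrite jump_step3 // eqxx (lt_eqF pq) (lt_eqF (lt_trans pq qs)) /= !addr0.
have js : jump (step3 p q s w1 w2 y) s = y.
  by rewrite jump_step3 // eqxx (gt_eqF qs) (gt_eqF (lt_trans pq qs)) /= !add0r.
by have := H_functional_ge h PC_step3 pab sab; rewrite jp js; apply.
Qed.

Lemma H_step3_le c :
  {in [:: w1; w2; y] &, forall z z', z != 0 -> z' != 0 -> h z z' <= c} ->
  (H_functional a b h (step3 p q s w1 w2 y) <= c%:E)%E.
Proof.
move=> hc; apply: ge_ereal_sup => _ [[t t'] [/= tS t'S] <-].
have jin x : jump_set a b (step3 p q s w1 w2 y) x ->
    jump (step3 p q s w1 w2 y) x != 0 /\
    jump (step3 p q s w1 w2 y) x \in [:: w1; w2; y].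
  rewrite (jump_setE PC_step3) => -[xab j0]; split=> //; move: j0.
  rewrite jump_step3 // !inE.
  have [->|_] := eqVneq x p.
    by rewrite (lt_eqF pq) (lt_eqF (lt_trans pq qs)) /= !addr0 eqxx.
  have [->|_] := eqVneq x q.
    by rewrite (lt_eqF qs) /= addr0 add0r eqxx orbT.
  by rewrite !add0r; case: ifP; rewrite ?eqxx ?orbT.
have [n1 i1] := jin _ tS; have [n2 i2] := jin _ t'S.
by rewrite lee_fin; apply: hc.
Qed.

End Step3.

Lemma L1_cvg_itv a b (un : (R -> R)^nat) u (K p q : R^nat) (C : R) :
  (forall n, measurable_fun `]a, b[ (un n)) -> measurable_fun `]a, b[ u ->
  (forall n, 0 <= K n) -> (forall n, p n < q n) ->
  (forall n x, x \in `]a, b[ ->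
    `|un n x - u x| <= K n * \1_(`[p n, q n[%classic) x) ->
  (forall n, K n * (q n - p n) <= C * n.+1%:R^-1) ->
  L1_cvg a b un u.
Proof.
move=> mun mfu K0 pq unu KC.
have C0 : ((C * n.+1%:R^-1)%:E : \bar R) @[n --> \oo] --> 0%E.
  apply: cvg_EFin; first exact: nearW.
  rewrite -(mulr0 C); apply: cvgM; [exact: cvg_cst|exact: cvg_harmonic].
apply: squeeze_cvge (cvg_cst 0%E) C0; apply: nearW => n.
rewrite integral_ge0 /=; last by move=> *; rewrite lee_fin.
apply: (@le_trans _ _ (K n * (q n - p n))%:E); last by rewrite lee_fin.
have mi : measurable_fun `]a, b[
    (fun x : R => ((K n)%:E * (\1_(`[p n, q n[%classic) x)%:E)%E).
  apply: measurable_funeM; apply/measurable_EFinP.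
  exact: measurable_indic.
have md : measurable_fun `]a, b[ (@EFin R \o (fun x => `|un n x - u x|)).
  apply/measurable_EFinP; apply: measurableT_comp => //.
  by apply: measurable_funB.
apply: (@le_trans _ _ (\int[mu]_(x in `]a, b[)
    ((K n)%:E * (\1_(`[p n, q n[%classic) x)%:E))%E).
  apply: ge0_le_integral => //.
  by move=> x xab; rewrite -EFinM lee_fin unu.
rewrite ge0_integralZl//; last first.
  by rewrite lee_fin.
  apply/measurable_EFinP; exact: measurable_indic.
rewrite EFinM; apply: lee_wpmul2l; first by rewrite lee_fin.
rewrite integral_indic //.
apply: (@le_trans _ _ (mu `[p n, q n[%classic)).
  by apply: le_measure; rewrite ?inE //; exact: measurableI.
by rewrite lebesgue_measure_itv /= lte_fin pq EFinB.
Qed.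

Lemma four_points a b : a < b ->
  exists p q s, [/\ a < p, p < q, q < s & s < b].
Proof.
move=> ab; exists (a + (b - a) / 4), (a + (b - a) / 2), (a + (b - a) * 3 / 4).
by split; lra.
Qed.

Lemma step3E p q s (w1 w2 y : R) x : step3 p q s w1 w2 y x =
  (if p <= x then w1 else 0) +
  ((if q <= x then w2 else 0) + if s <= x then y else 0).
Proof. by []. Qed.

(** * Necessity: lower semicontinuity and submaximality of the density *)

Section Necessity.
Variables (a b : R) (h : R -> R -> R).
Hypotheses (ab : a < b) (hdiag : diagonal_density h).
Hypothesis H_lsc : PC_lsc a b (H_functional a b h).

Lemma density_lsc_of_H : density_lsc h.
Proof.
move=> z c cz; have [Az|Az] := pselect (@nonzero_pairs R z); last first.
  (* Points outside [nonzero_pairs] are isolated in the subspace topology, so the singleton is a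
     neighbourhood. *)
  exists [set z]; last by move=> _ ->.
  by case: (nbhs_subspaceP (@nonzero_pairs R) z) => // _ _ ->.
case: z Az cz => x y [/= x0 y0] cz; apply: contrapT => noV.
(* If lower semicontinuity fails at [(x, y)], pairs with density at most [c] converge to it; they
   become the jumps of the test functions. *)
have near n : exists z : R * R, [/\ z.1 != 0, z.2 != 0,
    `|z.1 - x| < n.+1%:R^-1, `|z.2 - y| < n.+1%:R^-1 & h z.1 z.2 <= c].
  apply: contrapT => /forallNP no; apply: noV.
  exists (@nonzero_pairs R `&` ball ((x, y) : R * R) (n.+1%:R^-1 : R)).
    have Axy : (@nonzero_pairs R) (x, y) by [].
    rewrite /nbhs /= -(nbhs_subspace_in Axy).
    have nb : nbhs ((x, y) : R * R) (ball ((x, y) : R * R) (n.+1%:R^-1 : R)).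
      by apply: nbhsx_ballx; rewrite invr_gt0.
    by apply: filterS nb => z zb Az.
  move=> z [[z1 z2] [zx zy]]; rewrite lte_fin ltNge; apply/negP => hz.
  by apply: (no z); split=> //; rewrite distrC.
have [z zP] := choice near.
have [p [q [s [ap pq qs sb]]]] := four_points ab.
pose un n := step3 p q s (z n).1 0 (z n).2.
have PCn n : PC a b (un n) by exact: PC_step3.
have PCu : PC a b (step3 p q s x 0 y) by exact: PC_step3.
have unu : L1_cvg a b un (step3 p q s x 0 y).
  (* The factor 2 counts the two perturbed jumps, each moved by less than [1 / (n + 1)]. *)
  apply: (@L1_cvg_itv a b un _ (fun n => 2 * n.+1%:R^-1) (fun=> a) (fun=> b)
    (2 * (b - a))) => //.
  - by move=> n; exact: (PCn n).1.
  - exact: PCu.1.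
  - move=> n t tab; rewrite indicE mem_set; last first.
      by move: tab; rewrite /= !in_itv /= => /andP[/ltW-> ->].
    have [_ _ zx zy _] := zP n.
    have -> : un n t - step3 p q s x 0 y t =
        (if p <= t then (z n).1 - x else 0) +
        (if s <= t then (z n).2 - y else 0).
      by rewrite /un !step3E; do 3 case: ifP => _; ring.
    rewrite mulr1 mulr_natl mulr2n; apply: le_trans (ler_normD _ _) _.
    apply: lerD; case: ifP => _; rewrite ?normr0 ?invr_ge0 //; exact: ltW.
  - by move=> n; rewrite mulrAC.
have := H_lsc PCn PCu unu; apply/negP; rewrite -ltNge.
apply: (@le_lt_trans _ _ c%:E); last first.
  by apply: lt_le_trans cz _; apply: H_step3_ge.
apply: limn_einf_le => n; apply: H_step3_le => //.
(* The functional also sees the equal and the swapped pairs of jumps; diagonality bounds them by the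
   value at [z n]. *)
have [z1 z2 _ _ hz] := zP n; have [d1 d2 d3] := diagonal_le hdiag z1 z2.
move=> w w'; rewrite !inE => /or3P[]/eqP-> /or3P[]/eqP->;
  rewrite ?eqxx // => _ _.
- exact: le_trans hz.
- exact: le_trans hz.
- exact: le_trans hz.
Qed.

Lemma submaximal_of_H : Cartesian_submaximal h.
Proof.
move=> w1 w2 y.
(* The extension by the infimum is a lower bound for every value of [ext0]; this settles [y = 0] and
   [w1 + w2 = 0], while [w1 = 0] or [w2 = 0] makes the left side one of the terms on the right. *)
have ext0_ge (x z : R) :
    (ereal_inf [set (h r.1 r.2)%:E | r in @nonzero_pairs R] <= ext0 h x z)%E.
  rewrite /ext0; case: ifP => // /andP[x0 z0].
  by apply: ereal_inf_lbound; exists (x, z).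
have [->|n1] := eqVneq w1 0; first by rewrite add0r !le_max lexx orbT.
have [->|n2] := eqVneq w2 0; first by rewrite addr0 !le_max lexx.
have [->|ny] := eqVneq y 0.
  by rewrite {1}/ext0 eqxx andbF le_max ext0_ge orbT.
have [->|n12] := eqVneq (w1 + w2) 0.
  by rewrite {1}/ext0 eqxx le_max ext0_ge orbT.
rewrite /ext0 n1 n2 ny n12 /= -!EFin_max.
set c := Num.max _ _.
have [h1 h2 h12] : [/\ h w1 y <= c, h w2 y <= c & h w1 w2 <= c].
  by rewrite /c !le_max !lexx !orbT.
have [p [q [s [ap pq qs sb]]]] := four_points ab.
(* The second jump slides towards the first; it starts at [qn 0 = q], so it always stays left of
   [s]. *)
pose qn n := p + (q - p) * n.+1%:R^-1.
have pqn n : p < qn n by rewrite ltrDl mulr_gt0 ?subr_gt0 // invr_gt0.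
have qns n : qn n < s.
  apply: le_lt_trans qs; rewrite /qn -lerBrDl ler_piMr ?subr_ge0 ?(ltW pq) //.
  by rewrite invf_le1 // ler1n.
pose un n := step3 p (qn n) s w1 w2 y.
have PCn n : PC a b (un n) by exact: PC_step3.
have PCu : PC a b (step3 p q s (w1 + w2) 0 y) by exact: PC_step3.
have unu : L1_cvg a b un (step3 p q s (w1 + w2) 0 y).
  apply: (@L1_cvg_itv a b un _ (fun=> `|w2|) (fun=> p) qn
    (`|w2| * (q - p))) => //.
  - by move=> n; exact: (PCn n).1.
  - exact: PCu.1.
  - move=> n t _.
    (* The functions differ only between the two merging jumps, where [un n] has not yet gained
       [w2]. *)
    have -> : un n t - step3 p q s (w1 + w2) 0 y t =
        - w2 * \1_(`[p, qn n[%classic) t.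
      rewrite /un !step3E indicE mem_setE in_itv /=.
      have [tp|pt] := ltP t p.
        by rewrite [qn n <= t]leNgt (lt_trans tp (pqn n)) /=;
          do 2 case: ifP => _; ring.
      by rewrite leNgt; case: (t < qn n) => /=; do 2 case: ifP => _; ring.
    by rewrite normrM normrN [X in _ * X]ger0_norm // indicE.
  - by move=> n; rewrite /qn addrAC subrr add0r mulrA.
apply: le_trans (H_step3_ge ap pq qs sb h 0 n12 ny) _.
apply: le_trans (H_lsc PCn PCu unu) _.
apply: limn_einf_le => n; apply: H_step3_le => //.
(* The three off-diagonal pairs are bounded by [c] by its definition; diagonality extends the bound
   to the diagonal and swapped pairs. *)
have [d1 d2 d3] := diagonal_le hdiag n1 ny.
have [e1 e2 e3] := diagonal_le hdiag n2 ny.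
have [f1 f2 f3] := diagonal_le hdiag n1 n2.
move=> w w'; rewrite !inE => /or3P[]/eqP-> /or3P[]/eqP-> _ _ //.
- exact: le_trans h1.
- exact: le_trans h12.
- exact: le_trans h12.
- exact: le_trans h1.
- exact: le_trans h2.
- exact: le_trans h1.
Qed.

End Necessity.

End PiecewiseConstantFunctions.

Theorem theorem1p1 (R : realType) (a b : R) (h : R -> R -> R)
    (ab : a < b) (hsym : symmetric_density h) (hdiag : diagonal_density h) :
  PC_lsc a b (H_functional a b h) <->
  density_lsc h /\ Cartesian_submaximal h.
Proof.
split=> [H_lsc|[hlsc hsub]]; last exact: lsc_of_submaximal.
by split; [exact: density_lsc_of_H H_lsc|exact: submaximal_of_H H_lsc].
Qed.
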